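(* Let $\mathcal{A}\subseteq\mathbb{R}^n$ be a non-empty finite set and let $(A,\beta)\in I(\mathcal{A})$ be a circuit whose barycentric coordinates $\lambda_\alpha$, $\alpha\in A$, are rational, with smallest common denominator $p$ and $m=\lceil\log_2 p\rceil$. Then the set of coefficient vectors of the cone $P^{\mathrm{even}}_{A,\beta}$ of non-negative even circuit functions supported on $(A,\beta)$ coincides with the projection of the spectrahedron $$\widehat{P^{\mathrm{even}}_{A,\beta}}:=\left\{(\mathbf{c},\mathbf{x})\in\mathbb{R}^{\mathcal{A}}\times\mathbb{R}^{2^{m}}\ :\ C_{A,\beta}(\mathbf{c}_{|A\cup\{\beta\}},x_\beta,\mathbf{x})\succeq 0,\ \ \mathbf{c}_{|\mathcal{A}\setminus(A\cup\{\beta\})}=0\right\}$$ on the coordinates $(\mathbf{c}_{|A},c_\beta)$. Moreover, the cone $P^{\mathrm{even}}_{A,\beta}$ is second-order representable.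
   Context: $\mathbb{N}=\{0,1,2,\dots\}$, $[r]=\{1,\dots,r\}$, $\succeq 0$ means positive semidefinite, $\mathbf{c}_{|S}$ is the restriction of $\mathbf{c}$ to coordinates indexed by $S$. Circuits: $I(\mathcal{A})$ is the set of pairs $(A,\beta)$ with $A\subseteq\mathcal{A}$ affinely independent and $\beta\in\operatorname{relint}(\operatorname{conv}A)\cap(\mathcal{A}\setminus A)$. The barycentric coordinates $\lambda=(\lambda_\alpha)_{\alpha\in A}$ are the unique numbers with $\sum_{\alpha\in A}\lambda_\alpha\alpha=\beta$, $\sum_{\alpha\in A}\lambda_\alpha=1$ (all are positive). Write $\lambda_\alpha=p_\alpha/p$ with $p_\alpha,p\in\mathbb{N}$ and $p$ minimal; $m=\lceil\log_2 p\rceil$. Even AG cone: $P^{\mathrm{even}}_{A,\beta}$ is the cone of functions $f(\mathbf{x})=\sum_{\alpha\in A}c_\alpha|\mathbf{x}|^\alpha+c_\beta|\mathbf{x}|^\beta$ with $c_\alpha\ge 0$ for $\alpha\in A$, $c_\beta\in\mathbb{R}$, and $f(\mathbf{x})\ge 0$ for all $\mathbf{x}\in\mathbb{R}^n$, where $|\mathbf{x}|^\alpha=\prod_j|x_j|^{\alpha_j}$ (set to $\infty$ if some $x_j=0$ has negative exponent). Non-negativity of $f$ is equivalent to non-negativity of the exponential sum $\mathbf{y}\mapsto\sum_{\alpha\in A}c_\alpha\exp(\alpha^T\mathbf{y})+c_\beta\exp(\beta^T\mathbf{y})$ on $\mathbb{R}^n$. Circuit matrix: the variables are $\mathbf{x}=(x_\beta,(x_{k,i})_{k,i})$,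 $k\in[m]$, $i\in[2^{m-k}]$ ($2^m$ variables in total). Let $\Lambda=\prod_{\alpha\in A}\lambda_\alpha^{\lambda_\alpha}$. $C_{A,\beta}(\mathbf{c}_{|A\cup\{\beta\}},x_\beta,\mathbf{x})$ is the block diagonal matrix with the blocks (i) $\begin{pmatrix} x_{k-1,2i-1} & x_{k,i} \\ x_{k,i} & x_{k-1,2i} \end{pmatrix}$ for $k\in\{2,\dots,m\}$, $i\in[2^{m-k}]$; (ii) the two $1\times1$ blocks $(x_{m,1}-\Lambda x_\beta)$ and $(x_\beta+c_\beta)$; (iii) $2^{m-1}$ blocks $\begin{pmatrix} u & x_{1,l} \\ x_{1,l} & w \end{pmatrix}$, $l\in[2^{m-1}]$, where $u,w\in\{c_\alpha:\alpha\in A\}\cup\{\Lambda x_\beta\}$, arranged such that over all these blocks each $c_\alpha$ ($\alpha\in A$) appears exactly $p_\alpha$ times and $\Lambda x_\beta$ appears exactly $2^m-p$ times (any such arrangement may be fixed). A subset of $\mathbb{R}^N$ is second-order representable if it is a projection of the feasible set of a second-order cone program, i.e. of a set of the form $\{\mathbf{x}:\|A_i\mathbf{x}+\mathbf{b}_i\|_2\le\mathbf{c}_i^T\mathbf{x}+d_i,\ i\in[M]\}$ with real matrices $A_i$, vectors $\mathbf{b}_i,\mathbf{c}_i$ and reals $d_i$; for a cone of functions this refers to its set of coefficient vectors. *)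

(* Defs.v *)
From mathcomp Require Export all_boot all_order all_algebra finmap.
From mathcomp Require Export all_classical all_reals all_analysis.
Export numFieldNormedType.Exports.
Set Implicit Arguments.
Unset Strict Implicit.
Unset Printing Implicit Defensive.
Import Order.TTheory GRing.Theory Num.Theory.

Local Open Scope fset_scope.
Local Open Scope classical_set_scope.
Local Open Scope ring_scope.

(* R^S is [{ffun S -> R}].  For a subtype S of T (a finite set S : {fset T}, or
   'I_N inside nat), [coord c v] is the coordinate of c at v; it is the junk
   value 0 when v lies outside S. *)
Definition coord (R : nmodType) (T : Type) (P : pred T) (S : subType P)
    (c : S -> R) (v : T) : R :=
  oapp c 0 (insub v).

Definition restr (R : nmodType) (K : choiceType) (X S : {fset K})
    (c : {ffun X -> R}) : {ffun S -> R} :=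
  [ffun v : S => coord c (val v)].

Section Convexity.
Variables (R : realType) (n : nat).
Local Notation V := 'rV[R]_n.

Definition affine_hull (S : set V) : set V :=
  [set x | exists (k : nat) (s : 'I_k -> V) (w : 'I_k -> R),
    [/\ forall i, S (s i), \sum_i w i = 1 & \sum_i w i *: s i = x]].

Definition convex_hull (S : set V) : set V :=
  [set x | exists (k : nat) (s : 'I_k -> V) (w : 'I_k -> R),
    [/\ forall i, S (s i), forall i, 0 <= w i,
        \sum_i w i = 1 & \sum_i w i *: s i = x]].

Definition relint (C : set V) : set V :=
  [set x | C x /\ \forall y \near x, affine_hull C y -> C y].

Definition affinely_independent (A : {fset V}) : Prop :=
  forall mu : A -> R,
    \sum_(a : A) mu a = 0 -> \sum_(a : A) mu a *: val a = 0 ->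
    forall a : A, mu a = 0.

Definition circuits (X : {fset V}) : set ({fset V} * V) :=
  [set Ab | [/\ (Ab.1 `<=` X)%fset, affinely_independent Ab.1,
    relint (convex_hull [set` Ab.1]) Ab.2 & Ab.2 \in (X `\` Ab.1)%fset]].

Definition barycentric (A : {fset V}) (b : V) (lam : A -> R) : Prop :=
  \sum_(a : A) lam a *: val a = b /\ \sum_(a : A) lam a = 1.

Definition smallest_common_denominator (A : {fset V}) (lam : A -> R)
    (pA : A -> nat) (p : nat) : Prop :=
  [/\ (0 < p)%N,
      forall a : A, lam a = (pA a)%:R / p%:R &
      forall (q : nat) (qA : A -> nat), (0 < q)%N ->
        (forall a : A, lam a = (qA a)%:R / q%:R) -> (p <= q)%N].

End Convexity.

Section EvenAG.
Variables (R : realType) (n : nat).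
Local Notation V := 'rV[R]_n.

Definition absmon (a x : V) : \bar R :=
  if [exists j, (x 0 j == 0) && (a 0 j < 0)] then +oo%E
  else (\prod_j `|x 0 j| `^ a 0 j)%:E.

(* The last sum uses [dual_adde], for which +oo + -oo = +oo, so that values lie
   in R with +oo wherever a term with positive coefficient is infinite.  With
   [adde], where +oo + -oo = -oo, the function |x|^-2 + |x|^-4 - |x|^-3
   would be negative at 0. *)
Definition even_ag (A : {fset V}) (b : V) (c : {ffun (b |` A)%fset -> R})
    (x : V) : \bar R :=
  dual_adde (\sum_(a : A) (coord c (val a))%:E * absmon (val a) x)%E
            ((coord c b)%:E * absmon b x)%E.

(* The cone of nonnegative even circuit functions, as coefficient vectors. *)
Definition even_cone (A : {fset V}) (b : V) : set {ffun (b |` A)%fset -> R} :=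
  [set c : {ffun (b |` A)%fset -> R} |
    (forall a : A, 0 <= coord c (val a)) /\
    forall x : V, (0 <= even_ag c x)%E].

End EvenAG.

Arguments even_cone {R n} A b.

Section CircuitMatrix.
Variables (R : realType) (n : nat).
Local Notation V := 'rV[R]_n.

Definition psdmx (k : nat) (M : 'M[R]_k) : Prop :=
  M^T = M /\ forall v : 'cV[R]_k, 0 <= (v^T *m M *m v) 0 0.

Definition sym2 (u x w : R) : 'M[R]_2 :=
  \matrix_(i, j) if i == j then (if i == 0 then u else w) else x.

(* The 2^m auxiliary variables are stored in heap order: x_beta has index 0 and
   x_{k,i} (1 <= k <= m, 1 <= i <= 2^(m-k)) has index 2^(m-k) + i - 1, which
   is a bijection onto {1, ..., 2^m - 1}.  [xki] takes k and i 1-based. *)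
Definition xbeta (m : nat) (x : {ffun 'I_(2 ^ m) -> R}) : R := coord x 0%N.
Definition xki (m : nat) (x : {ffun 'I_(2 ^ m) -> R}) (k i : nat) : R :=
  coord x (2 ^ (m - k) + i.-1)%N.

Definition Lambda (A : {fset V}) (lam : A -> R) : R :=
  \prod_(a : A) lam a `^ lam a.

(* Labels of the diagonal entries in the leaf blocks: [Some a] stands for c_a
   and [None] for Lambda * x_beta. *)
Definition arrangement (A : {fset V}) (pA : A -> nat) (p m : nat)
    (u w : 'I_(2 ^ m.-1) -> option A) : Prop :=
  (forall a : A, #|[pred l | u l == Some a]| + #|[pred l | w l == Some a]|
                 = pA a)%N /\
  (#|[pred l | u l == None]| + #|[pred l | w l == None]| = 2 ^ m - p)%N.

Section Matrix.
Variables (A : {fset V}) (b : V) (lam : A -> R) (m : nat).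
Variables (u w : 'I_(2 ^ m.-1) -> option A).
Variables (c : {ffun (b |` A)%fset -> R}) (x : {ffun 'I_(2 ^ m) -> R}).

Definition entry (s : option A) : R :=
  if s is Some a then coord c (val a) else Lambda lam * xbeta x.

Definition inner_block (k i : nat) : 'M[R]_2 :=
  sym2 (xki x k.-1 (2 * i).-1) (xki x k i) (xki x k.-1 (2 * i)).

(* k ranges over {2, ..., m} and i over {1, ..., 2^(m-k)}. *)
Definition inner_blocks :=
  \mxdiag_(k < m.-1) \mxdiag_(i < 2 ^ (m - k.+2)) inner_block k.+2 i.+1.

Definition root_blocks : 'M[R]_(1 + 1) :=
  block_mx (xki x m 1 - Lambda lam * xbeta x)%:M 0
           0 (xbeta x + coord c b)%:M.

Definition leaf_blocks :=
  \mxdiag_(l < 2 ^ m.-1) sym2 (entry (u l)) (xki x 1 l.+1) (entry (w l)).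

Definition circuit_matrix :=
  block_mx inner_blocks 0 0 (block_mx root_blocks 0 0 leaf_blocks).

End Matrix.

Definition circuit_spectrahedron (X A : {fset V}) (b : V) (lam : A -> R)
    (m : nat) (u w : 'I_(2 ^ m.-1) -> option A) :
    set ({ffun X -> R} * {ffun 'I_(2 ^ m) -> R}) :=
  [set cx | psdmx (circuit_matrix lam u w (restr (b |` A)%fset cx.1) cx.2) /\
            forall v : X, val v \notin (b |` A)%fset -> cx.1 v = 0].

End CircuitMatrix.

Arguments circuit_spectrahedron {R n} X A b lam {m} u w.

Section SecondOrderCone.
Variable R : realType.

(* The library norm on matrices is the sup norm. *)
Definition l2norm (k : nat) (v : 'cV[R]_k) : R :=
  Num.sqrt (\sum_i v i 0 ^+ 2).

Definition socp_feasible (N M : nat) (d : 'I_M -> nat)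
    (P : forall i, 'M[R]_(d i, N)) (q : forall i, 'cV[R]_(d i))
    (r : 'I_M -> 'cV[R]_N) (t : 'I_M -> R) : set 'cV[R]_N :=
  [set z | forall i, l2norm (P i *m z + q i) <= ((r i)^T *m z) 0 0 + t i].

Definition soc_representable (N : nat) (S : set 'cV[R]_N) : Prop :=
  exists (k M : nat) (d : 'I_M -> nat) (P : forall i, 'M[R]_(d i, N + k))
    (q : forall i, 'cV[R]_(d i)) (r : 'I_M -> 'cV[R]_(N + k)) (t : 'I_M -> R),
    S = usubmx @` socp_feasible P q r t.

Definition colvec (I : finType) (c : {ffun I -> R}) : 'cV[R]_#|I| :=
  \col_i c (enum_val i).

End SecondOrderCone.

(* Main.v *)
(* By weighted AM-GM, and by solving a linear system (affine independence of A
   makes every choice of exponents on A attainable) to reach its equality case,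
   membership in the cone means: c_a >= 0 on A and
   Lambda * c_b >= - \prod_a c_a ^ lam_a.  Chaining the blocks
   x_h ^ 2 <= x_(2h) * x_(2h+1) along a complete binary tree bounds the
   2^m-th power of the root by the product of the leaves,
   \prod_a c_a ^ p_a * (Lambda * x_b) ^ (2^m - p), which gives that inequality
   after cancelling; conversely x_b = \prod_a (c_a / lam_a) ^ lam_a and iterated
   geometric means satisfy all blocks.  A 2x2 block is a second-order cone
   constraint: 0 <= u, 0 <= w, x ^ 2 <= u * w iff |(2 x, u - w)| <= u + w. *)
Require Import Defs.
From mathcomp Require Import ring lra zify.
Set Implicit Arguments.
Unset Strict Implicit.
Unset Printing Implicit Defensive.
Import Order.TTheory GRing.Theory Num.Theory.
Local Open Scope fset_scope.
Local Open Scope classical_set_scope.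
Local Open Scope ring_scope.

(** * Barycentric coordinates over an affinely independent set *)

Section Barycentric.
Variables (R : realType) (n : nat) (A : {fset 'rV[R]_n}).

Lemma barycentric_unique (x : 'rV[R]_n) (lam mu : A -> R) :
  affinely_independent A -> barycentric x lam -> barycentric x mu ->
  forall a, lam a = mu a.
Proof.
move=> Aind [lamx lam1] [mux mu1] a; apply/subr0_eq.
apply: (Aind (fun a => lam a - mu a)).
  by rewrite sumrB lam1 mu1 subrr.
by under eq_bigr do rewrite scalerBl; rewrite sumrB lamx mux subrr.
Qed.

(** A convex combination may list the same point of [A] several times; the weights of all indices
    with the same point [t i] are merged. *)
Lemma convex_hull_barycentric (x : 'rV[R]_n) :
  convex_hull [set` A] x ->
  exists2 mu : A -> R, barycentric x mu & forall a, 0 <= mu a.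
Proof.
move=> [k [s [w [sA w0 w1 wx]]]].
pose t i : A := [` sA i].
exists (fun a => \sum_(i | t i == a) w i); last first.
  by move=> a; apply: sumr_ge0.
split.
  rewrite -wx [RHS](partition_big t xpredT) //=.
  apply: eq_bigr => a _; rewrite scaler_suml.
  by apply: eq_bigr => i /eqP <-.
by rewrite -w1 [RHS](partition_big t xpredT).
Qed.

(** If [lam a] were 0, a small step from [b] directly away from [a] would stay in the hull, by
    relative interiority, yet have a negative coordinate at [a]. *)
Lemma relint_barycentric_gt0 (b : 'rV[R]_n) (lam : A -> R) :
  affinely_independent A -> relint (convex_hull [set` A]) b ->
  barycentric b lam -> forall a, 0 < lam a.
Proof.
move=> Aind [bconv bint] lamP a.
have [mu muP mu0] := convex_hull_barycentric bconv.
have lam0 a' : 0 <= lam a' by rewrite (barycentric_unique Aind lamP muP).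
rewrite lt_neqAle lam0 andbT eq_sym; apply/negP => /eqP lama0.
have cvgb : (fun t : R => b + t *: (b - val a)) @ 0 --> b.
  rewrite -[X in _ --> X]addr0 -(scale0r (b - val a)).
  apply: cvgD; first exact: cvg_cst.
  exact: scalel_continuous.
have [e /= e0 He] : \forall t \near (0 : R),
    affine_hull (convex_hull [set` A]) (b + t *: (b - val a)) ->
    convex_hull [set` A] (b + t *: (b - val a)) := cvgb _ bint.
have aconv : convex_hull [set` A] (val a).
  exists 1%N, (fun=> val a), (fun=> 1).
  by split=> [_||//|]; rewrite ?big_ord1 ?scale1r//; apply: valP.
pose t := e / 2.
have t0 : 0 < t by rewrite divr_gt0.
have tconv : convex_hull [set` A] (b + t *: (b - val a)).
  apply: (He t).
    by rewrite /ball_/= sub0r normrN gtr0_norm // ltr_pdivrMr // ltr_pMr // ltr1n.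
  (* The moved point is the affine combination of [b] and [a] with weights [1 + t] and [- t]. *)
  exists 2%N, (fun i => if i == ord0 then b else val a),
    (fun i => if i == ord0 then 1 + t else - t); split.
  - by move=> i; case: ifP.
  - by rewrite big_ord_recl big_ord1 /= addrK.
  - rewrite big_ord_recl big_ord1 /= scalerDl scale1r scalerBr scaleNr.
    by rewrite addrA.
have [nu nuP nu0] := convex_hull_barycentric tconv.
(* At [a] these coordinates equal [- t], since [lam a = 0]. *)
have nu'P : barycentric (b + t *: (b - val a))
    (fun a' => lam a' + t * (lam a' - (a' == a)%:R)).
  case: lamP => lamb lam1; split.
    under eq_bigr do rewrite scalerDl -scalerA scalerBl.
    rewrite big_split /= -scaler_sumr sumrB lamb (bigD1 a) //= eqxx scale1r.
    by rewrite big1 ?addr0 // => i /negbTE ->; rewrite scale0r.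
  rewrite big_split /= -mulr_sumr sumrB lam1 (bigD1 a) //= eqxx.
  by rewrite big1 ?addr0 ?subrr ?mulr0 ?addr0 // => i /negbTE ->.
have := nu0 a.
rewrite (barycentric_unique Aind nuP nu'P) lama0 eqxx.
by rewrite add0r sub0r mulrN1 oppr_ge0 leNgt t0.
Qed.

(** Affine independence says that the rows [(a, 1)] are linearly independent, so their matrix has a
    right inverse; the appended 1 produces the constant [s]. *)
Lemma affinely_independent_interpolation (g : A -> R) :
  affinely_independent A ->
  exists (y : 'rV[R]_n) (s : R),
    forall a : A, \sum_j val a 0 j * y 0 j + s = g a.
Proof.
move=> Aind.
pose M : 'M[R]_(#|{: A}|, n + 1) :=
  \matrix_i row_mx (val (enum_val i : A)) 1%:M.
have : row_free M.
  apply/inj_row_free => v vM0; apply/rowP => i; rewrite mxE.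
  pose mu (a : A) := v 0 (enum_rank a).
  have vM : v *m M = row_mx (\sum_(a : A) mu a *: val a)
                            (\sum_(a : A) mu a)%:M.
    rewrite mulmx_sum_row.
    rewrite (reindex_onto (@enum_rank A) enum_val) /=; last first.
      by move=> j _; rewrite enum_valK.
    under eq_bigl do rewrite enum_rankK eqxx.
    under eq_bigr do rewrite rowK enum_rankK scale_row_mx.
    rewrite -[LHS]hsubmxK !linear_sum /=; congr row_mx.
      by apply: eq_bigr => a _; rewrite row_mxKl.
    rewrite raddf_sum /=; apply: eq_bigr => a _.
    by rewrite row_mxKr scale_scalar_mx mulr1.
  move: vM0; rewrite vM -row_mx0 => /eq_row_mx[mub mu1].
  have mu10 : \sum_(a : A) mu a = 0.
    by have /matrixP/(_ 0 0) := mu1; rewrite !mxE mulr1n.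
  have := Aind mu mu10 mub (enum_val i).
  by rewrite /mu enum_valK.
case/row_freeP => B MB.
pose z := B *m \col_i g (enum_val i : A).
have Mz : M *m z = \col_i g (enum_val i : A) by rewrite mulmxA MB mul1mx.
exists (usubmx z)^T, (dsubmx z 0 0) => a.
have /matrixP/(_ (enum_rank a) 0) := Mz.
rewrite mxE [RHS]mxE enum_rankK => <-.
rewrite big_split_ord /= big_ord1; congr (_ + _).
  by apply: eq_bigr => j _; rewrite [M _ _]mxE enum_rankK row_mxEl !mxE.
by rewrite [M _ _]mxE enum_rankK row_mxEr !mxE mul1r.
Qed.

End Barycentric.

(** * The even cone described by the circuit number inequality *)

Section EvenCone.
Variables (R : realType).

(** With [S] the weighted mean, raise the tangent bound [y i / S <= expR (y i / S - 1)] to the power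
    [lam i] and multiply over [i]: the exponents on the right sum to 0. *)
Lemma weighted_AMGM (I : finType) (lam y : I -> R) :
  (forall i, 0 < lam i) -> \sum_i lam i = 1 -> (forall i, 0 <= y i) ->
  \prod_i y i `^ lam i <= \sum_i lam i * y i.
Proof.
move=> lam0 lam1 y0; set S := \sum_i _.
have S0 : 0 <= S by apply: sumr_ge0 => i _; rewrite mulr_ge0 // ltW.
have [Sgt0|] := ltrP 0 S; last first.
  move=> Sle0; have /eqP : S = 0 by apply/le_anti; rewrite Sle0.
  rewrite psumr_eq0 => [/allP yall|i _]; last by rewrite mulr_ge0 // ltW.
  have [i _|noI] := pickP (@predT I); last first.
    by have /eqP[] := oner_neq0 R; rewrite -lam1 big_pred0.
  have := yall i (mem_index_enum i); rewrite mulf_eq0 gt_eqF ?lam0 //= => /eqP yi.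
  by rewrite (bigD1 i) //= yi powR0 ?gt_eqF ?lam0 // mul0r.
have SE : S = \prod_i S `^ lam i.
  rewrite -[LHS](powRr1 S0) -[in LHS]lam1 /powR gt_eqF //.
  by rewrite mulr_suml expR_sum.
have expE : \prod_i expR (lam i * (y i / S - 1)) = 1.
  rewrite -expR_sum -[RHS]expR0; congr expR.
  under eq_bigr do rewrite mulrBr mulr1 mulrA.
  by rewrite sumrB -mulr_suml lam1 divff ?subrr // gt_eqF.
rewrite [leRHS]SE -[leRHS]mulr1 -[X in _ <= _ * X]expE.
rewrite -big_split /=; apply: ler_prod => i _; rewrite powR_ge0 /=.
rewrite mulrC (mulrC (lam i)) expRM -powRM ?expR_ge0 //.
apply: ge0_ler_powR; [exact: ltW|exact: y0| |].
  by rewrite nnegrE mulr_ge0 ?expR_ge0.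
rewrite -ler_pdivrMr //.
by have := expR_ge1Dx (y i / S - 1); rewrite addrC subrK.
Qed.

Lemma powR_prod (I : finType) (y : I -> R) (r : R) :
  (forall i, 0 <= y i) -> (\prod_i y i) `^ r = \prod_i y i `^ r.
Proof.
move=> y0; suff [] : 0 <= \prod_i y i /\ (\prod_i y i) `^ r = \prod_i y i `^ r by [].
apply: (big_ind2 (fun s t => 0 <= s /\ s `^ r = t)) => [|s1 t1 s2 t2|i _].
- by rewrite powR1.
- by move=> [s10 <-] [s20 <-]; rewrite mulr_ge0 ?powRM.
- by [].
Qed.

Variables (n : nat) (A : {fset 'rV[R]_n}) (b : 'rV[R]_n) (lam : A -> R).
Hypotheses (Aind : affinely_independent A) (lamP : barycentric b lam).
Hypothesis (lam_gt0 : forall a, 0 < lam a).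

Lemma Lambda_gt0 : 0 < Lambda lam.
Proof. by apply: prodr_gt0 => a _; apply: powR_gt0. Qed.

Lemma barycentric_coord j : b 0 j = \sum_(a : A) lam a * val a 0 j.
Proof.
case: lamP => <- _; rewrite summxE.
by apply: eq_bigr => a _; rewrite mxE.
Qed.

Lemma absmon_expR (a y : 'rV[R]_n) :
  absmon a (\row_j expR (y 0 j)) = (expR (\sum_j a 0 j * y 0 j))%:E.
Proof.
rewrite /absmon; case: existsP => [[j]|_]; first by rewrite mxE gt_eqF ?expR_gt0.
congr EFin; rewrite expR_sum; apply: eq_bigr => j _.
by rewrite mxE ger0_norm ?expR_ge0 // -expRM mulrC.
Qed.

(** Substituting [x = expR y] and multiplying by [expR s] turns the exponents on [A] into any
    prescribed [g]; the exponent at [b] is then forced to be the [lam]-weighted mean of [g]. *)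
Lemma even_cone_expR_ge0 (c : {ffun (b |` A)%fset -> R}) (g : A -> R) :
  even_cone A b c ->
  0 <= \sum_(a : A) coord c (val a) * expR (g a)
       + coord c b * expR (\sum_a lam a * g a).
Proof.
move=> [_ cge0].
have [y [s ys]] := affinely_independent_interpolation g Aind.
have := cge0 (\row_j expR (y 0 j)); rewrite /even_ag absmon_expR.
under eq_bigr do rewrite absmon_expR.
rewrite -EFinM; under eq_bigr do rewrite -EFinM.
rewrite sumEFin /dual_adde lee_fin => f0.
have := mulr_ge0 f0 (expR_ge0 s).
rewrite mulrDl mulr_suml -!mulrA -expRD.
under eq_bigr do rewrite -mulrA -expRD ys.
congr (0 <= _ + _ * expR _).
under [RHS]eq_bigr do rewrite -ys mulrDr mulr_sumr.
rewrite big_split /= -mulr_suml (proj2 lamP) mul1r; congr (_ + _).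
rewrite exchange_big /=; apply: eq_bigr => j _.
rewrite barycentric_coord mulr_suml.
by apply: eq_bigr => a _; rewrite mulrA.
Qed.

Lemma even_cone_circuit_number (c : {ffun (b |` A)%fset -> R}) :
  even_cone A b c ->
  - (\prod_(a : A) coord c (val a) `^ lam a) <= Lambda lam * coord c b.
Proof.
move=> cP; have [cA _] := cP.
set E := \prod_(a : A) _.
have E0 : 0 <= E by apply: prodr_ge0 => a _; apply: powR_ge0.
have [cb|cb] := leP 0 (coord c b).
  by rewrite (@le_trans _ _ 0) ?oppr_le0 // mulr_ge0 // ltW // Lambda_gt0.
have [/existsP[a0 /eqP ca0]|/existsPn cn0] :=
    boolP [exists a : A, coord c (val a) == 0].
  (* When [c_a0 = 0], letting the a0-term grow leaves the positive part of the
     sum bounded while the b-term tends to minus infinity. *)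
  exfalso.
  pose C := \sum_(a : A) coord c (val a).
  (* Chosen so that the exponent at [b], namely [lam a0 * L], is [C / - coord c b]; then
     [1 + t <= expR t] makes the negative term exceed [C]. *)
  pose L := C / - coord c b / lam a0.
  have := even_cone_expR_ge0 (fun a => if a == a0 then L else 0) cP.
  have -> : \sum_a lam a * (if a == a0 then L else 0) = C / - coord c b.
    rewrite (bigD1 a0) //= eqxx big1 => [|a /negbTE->]; last exact: mulr0.
    by rewrite addr0 mulrC divfK // gt_eqF.
  have -> : \sum_(a : A) coord c (val a) * expR (if a == a0 then L else 0) = C.
    apply: eq_bigr => a _; case: eqP => [->|_]; first by rewrite ca0 !mul0r.
    by rewrite expR0 mulr1.
  apply/negP; rewrite -ltNge.
  have ncb : 0 < - coord c b by rewrite oppr_gt0.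
  rewrite -[coord c b]opprK mulNr opprK subr_lt0.
  rewrite -ltr_pdivrMl // mulrC.
  by apply: lt_le_trans (expR_ge1Dx _); rewrite ltrDr.
have {}cn0 (a : A) : 0 < coord c (val a) by rewrite lt_neqAle eq_sym cn0 cA.
have Egt0 : 0 < E by apply: prodr_gt0 => a _; apply: powR_gt0.
(* At this point all terms of the weighted AM-GM inequality are equal. *)
have := even_cone_expR_ge0 (fun a => ln (lam a / coord c (val a))) cP.
have -> : \sum_(a : A) coord c (val a) * expR (ln (lam a / coord c (val a))) = 1.
  rewrite -(proj2 lamP); apply: eq_bigr => a _.
  by rewrite lnK ?posrE ?divr_gt0 // mulrC divfK // gt_eqF.
have -> : expR (\sum_(a : A) lam a * ln (lam a / coord c (val a)))
          = Lambda lam / E.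
  rewrite expR_sum /Lambda /E -prodf_div; apply: eq_bigr => a _.
  rewrite ln_div ?posrE // mulrBr expRD expRN /powR.
  by rewrite !gt_eqF.
rewrite -(pmulr_lge0 _ Egt0) mulrDl mul1r -mulrA divfK ?gt_eqF //.
by rewrite addrC -lerBlDr sub0r mulrC.
Qed.

(** For a negative coefficient at [b], AM-GM bounds the positive part below by the circuit number
    times [|x|^b]. Infinite monomials and zero coordinates, which have no logarithm, are treated
    apart. *)
Lemma circuit_number_even_cone (c : {ffun (b |` A)%fset -> R}) :
  (forall a : A, 0 <= coord c (val a)) ->
  - (\prod_(a : A) coord c (val a) `^ lam a) <= Lambda lam * coord c b ->
  even_cone A b c.
Proof.
move=> cA cE; split=> // x; rewrite /even_ag.
have abs0 a : (0 <= absmon a x)%E.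
  rewrite /absmon; case: ifP => // _.
  by rewrite lee_fin; apply: prodr_ge0 => j _; apply: powR_ge0.
have term0 (a : A) : (0 <= (coord c (val a))%:E * absmon (val a) x)%E.
  by rewrite mule_ge0 // lee_fin.
have sum0 : (0 <= \sum_(a : A) (coord c (val a))%:E * absmon (val a) x)%E.
  exact: sume_ge0.
have [cb|cb] := leP 0 (coord c b).
  have := @mule_ge0 _ (coord c b)%:E (absmon b x).
  rewrite lee_fin => /(_ cb (abs0 b)); move: sum0.
  case: (\sum_(a : A) _)%E => [r||] //; case: (_ * _)%E => [t||] //=.
  by rewrite /dual_adde !lee_fin; apply: addr_ge0.
(* A vanishing coefficient on [A] would make the product 0, contradicting [c_b < 0]. *)
have cn0 (a : A) : 0 < coord c (val a).
  rewrite lt_neqAle eq_sym cA andbT; apply/negP => /eqP ca.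
  move: cE; rewrite (bigD1 a) //= ca powR0 ?gt_eqF // mul0r oppr0 leNgt.
  by rewrite nmulr_llt0 ?Lambda_gt0.
(* One infinite monomial with positive coefficient makes the sum [+oo], and [dual_adde] keeps it so
   even against [-oo]. *)
have [/existsP[a /eqP aoo]|/existsPn afin] :=
    boolP [exists a : A, absmon (val a) x == +oo%E].
  have -> : (\sum_(a : A) (coord c (val a))%:E * absmon (val a) x = +oo)%E.
    apply/esum_eqyP => [a' _|]; last first.
      exists a; split; rewrite ?mem_index_enum //.
      by rewrite aoo gt0_muley // lte_fin.
    by rewrite gt_eqF // (lt_le_trans _ (term0 a')) // ltNy0.
  by rewrite /dual_adde le0y.
have aneg (a : A) j : x 0 j = 0 -> 0 <= val a 0 j.
  move=> xj; rewrite leNgt; apply/negP => aj.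
  have := afin a; rewrite /absmon; case: existsP => //= -[]; exists j.
  by rewrite xj eqxx.
have monE (a : A) : absmon (val a) x = (\prod_j `|x 0 j| `^ val a 0 j)%:E.
  by have := afin a; rewrite /absmon; case: ifP.
have bneg j : x 0 j = 0 -> 0 <= b 0 j.
  move=> xj; rewrite barycentric_coord; apply: sumr_ge0 => a _.
  by rewrite mulr_ge0 ?aneg // ltW.
have -> : absmon b x = (\prod_j `|x 0 j| `^ b 0 j)%:E.
  rewrite /absmon; case: existsP => // -[j /andP[/eqP /bneg]].
  by rewrite leNgt => /negbTE ->.
under [X in dual_adde X _]eq_bigr => a _ do rewrite monE -EFinM.
rewrite sumEFin -EFinM /dual_adde lee_fin.
have -> : \prod_j `|x 0 j| `^ b 0 j
    = \prod_(a : A) (\prod_j `|x 0 j| `^ val a 0 j) `^ lam a.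
  transitivity (\prod_j \prod_(a : A) `|x 0 j| `^ (lam a * val a 0 j)).
    apply: eq_bigr => j _; rewrite barycentric_coord.
    (* At a zero coordinate the power is 0 for a nonzero exponent and 1 for exponent 0. Both sides
       agree because [b 0 j] is a sum of nonnegative terms, hence zero only if every term is. *)
    have [xj|xj] := eqVneq (x 0 j) 0; last first.
      by rewrite /powR normr_eq0 (negbTE xj) mulr_suml expR_sum.
    rewrite xj normr0.
    have la0 (a : A) : 0 <= lam a * val a 0 j by rewrite mulr_ge0 ?aneg // ltW.
    have [/existsP[a an0]|/existsPn a0] :=
        boolP [exists a : A, lam a * val a 0 j != 0].
      rewrite [RHS](bigD1 a) //= (powR0 an0) mul0r powR0 //.
      rewrite psumr_neq0 //; apply/hasP; exists a; first exact: mem_index_enum.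
      by rewrite lt_neqAle eq_sym an0 la0.
    have {}a0 (a : A) : lam a * val a 0 j = 0 by apply/eqP; rewrite -[_ == _]negbK a0.
    rewrite big1 // powRr0 big1 // => a _.
    by rewrite a0 powRr0.
  rewrite exchange_big /=; apply: eq_bigr => a _.
  rewrite powR_prod => [|j]; last exact: powR_ge0.
  by apply: eq_bigr => j _; rewrite mulrC powRrM.
set t := fun a : A => \prod_j `|x 0 j| `^ val a 0 j.
have t0 a : 0 <= t a by apply: prodr_ge0 => j _; apply: powR_ge0.
set E := \prod_(a : A) coord c (val a) `^ lam a in cE *.
set T := \prod_(a : A) t a `^ lam a.
have T0 : 0 <= T by apply: prodr_ge0 => a _; apply: powR_ge0.
(* Dividing by [lam a] makes the weighted mean equal to the positive part of the function; the
   geometric mean then carries the factor [1 / Lambda lam]. *)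
have := weighted_AMGM (y := fun a => coord c (val a) * t a / lam a)
  lam_gt0 (proj2 lamP).
have -> : \sum_i lam i * (coord c (val i) * t i / lam i)
          = \sum_(a : A) coord c (val a) * t a.
  by apply: eq_bigr => a _; rewrite mulrC divfK // gt_eqF.
have -> : \prod_(a : A) (coord c (val a) * t a / lam a) `^ lam a
          = E * T / Lambda lam.
  rewrite -big_split /= /Lambda -prodf_div; apply: eq_bigr => a _.
  have iv0 : 0 <= (lam a)^-1 by rewrite invr_ge0 ltW.
  have ca0 : 0 <= coord c (fsval a) := cA a.
  rewrite !powRM ?mulr_ge0 //; congr (_ * _).
  by rewrite /powR invr_eq0 !gt_eqF // lnV ?posrE // mulrN expRN.
move=> amgm; rewrite -lerBlDr sub0r; apply: le_trans (amgm _).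
  rewrite -mulNr mulrAC ler_wpM2r // ler_pdivlMr ?Lambda_gt0 //.
  by rewrite mulNr lerNl mulrC.
by move=> a; rewrite divr_ge0 ?mulr_ge0 // ltW.
Qed.

End EvenCone.

(** * Block positive semidefiniteness and second-order cone constraints *)

Section BlockPSD.
Variable R : realType.

Definition psd2 (u x w : R) : Prop := [/\ 0 <= u, 0 <= w & x ^+ 2 <= u * w].

(** For [w > 0], multiply the quadratic form by [w] and complete the square; the case [w = 0] forces
    [x = 0]. *)
Lemma psdmx_sym2 (u x w : R) : psdmx (sym2 u x w) <-> psd2 u x w.
Proof.
have quad (v : 'cV[R]_2) : (v^T *m sym2 u x w *m v) 0 0 =
    u * v 0 0 ^+ 2 + 2 * x * (v 0 0 * v 1 0) + w * v 1 0 ^+ 2.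
  rewrite mxE !big_ord_recl big_ord0 !mxE !big_ord_recl !big_ord0 !mxE /=.
  have -> : lift ord0 ord0 = 1 :> 'I_2 by apply/val_inj.
  ring.
split=> [[_ psd]|[u0 w0 xuw]]; last first.
  split; first by apply/matrixP => i j; rewrite !mxE eq_sym; case: eqP => // ->.
  move=> v; rewrite quad.
  have [w_gt0|] := ltrP 0 w; last first.
    move=> wle0; have w_eq0 : w = 0 by apply/le_anti; rewrite wle0.
    have /eqP : x ^+ 2 = 0.
      by apply/le_anti; rewrite sqr_ge0 andbT; rewrite w_eq0 mulr0 in xuw.
    rewrite sqrf_eq0 => /eqP ->; rewrite w_eq0 mulr0 !mul0r !addr0.
    by rewrite mulr_ge0 ?sqr_ge0.
  rewrite -(pmulr_rge0 _ w_gt0).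
  have -> : w * (u * v 0 0 ^+ 2 + 2 * x * (v 0 0 * v 1 0) + w * v 1 0 ^+ 2)
      = (u * w - x ^+ 2) * v 0 0 ^+ 2 + (x * v 0 0 + w * v 1 0) ^+ 2 by ring.
  by rewrite addr_ge0 ?sqr_ge0 // mulr_ge0 ?sqr_ge0 // subr_ge0.
have psd' (s t : R) : 0 <= u * s ^+ 2 + 2 * x * (s * t) + w * t ^+ 2.
  have := psd (\col_i if i == 0 then s else t).
  by rewrite quad !mxE /=.
have u0 : 0 <= u by have := psd' 1 0; rewrite !expr2; lra.
have w0 : 0 <= w by have := psd' 0 1; rewrite !expr2; lra.
split=> //; have [w_gt0|] := ltrP 0 w; last first.
  move=> wle0; have w_eq0 : w = 0 by apply/le_anti; rewrite wle0.
  (* With [w = 0] this test vector gives the value [- ((u + 2) * x ^+ 2)]. *)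
  have := psd' (- x) (u + 1); rewrite w_eq0 mulr0.
  have -> : u * (- x) ^+ 2 + 2 * x * (- x * (u + 1)) + 0 * (u + 1) ^+ 2
      = - ((u + 2) * x ^+ 2) by ring.
  by rewrite oppr_ge0 pmulr_rle0 // ltr_wpDl.
rewrite -subr_ge0 -(pmulr_rge0 _ w_gt0).
(* This is the quadratic form at the test vector [(w, - x)]. *)
have -> : w * (u * w - x ^+ 2) = u * w ^+ 2 + 2 * x * (w * - x) + w * (- x) ^+ 2.
  by ring.
exact: psd'.
Qed.

Lemma psdmx_scalar (a : R) : psdmx (a%:M : 'M[R]_1) <-> (0 <= a).
Proof.
split=> [[_ /(_ 1%:M)]|a0].
  by rewrite trmx1 mul1mx mulmx1 !mxE.
split=> [|v]; first exact: tr_scalar_mx.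
rewrite mul_mx_scalar -scalemxAl !mxE big_ord1 mxE.
by rewrite mulr_ge0 // -expr2 sqr_ge0.
Qed.

Lemma psdmx_block_diag k l (M : 'M[R]_k) (N : 'M[R]_l) :
  psdmx (block_mx M 0 0 N) <-> psdmx M /\ psdmx N.
Proof.
have quad (v : 'cV_k) (w : 'cV_l) :
    (col_mx v w)^T *m block_mx M 0 0 N *m col_mx v w
    = v^T *m M *m v + w^T *m N *m w.
  by rewrite tr_col_mx mul_row_block !mulmx0 addr0 add0r mul_row_col.
split=> [[/eqP]|[[MT Mge0] [NT Nge0]]].
  rewrite tr_block_mx !trmx0 => /eqP/eq_block_mx[MT _ _ NT] ge0.
  split; split=> // v.
    by have := ge0 (col_mx v 0); rewrite quad mulmx0 addr0.
  by have := ge0 (col_mx 0 v); rewrite quad mulmx0 add0r.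
split=> [|v]; first by rewrite tr_block_mx !trmx0 MT NT.
by rewrite -[v]vsubmxK quad mxE addr_ge0.
Qed.

Lemma psdmx_mxdiag k (d : 'I_k -> nat) (B : forall i, 'M[R]_(d i)) :
  psdmx (\mxdiag_i B i) <-> forall i, psdmx (B i).
Proof.
have quad (v : forall i, 'cV_(d i)) :
    (\mxcol_i v i)^T *m (\mxdiag_i B i) *m (\mxcol_i v i)
    = \sum_i (v i)^T *m B i *m v i.
  rewrite tr_mxcol -mulmxA mul_mxdiag_mxcol mul_mxrow_mxcol.
  by under eq_bigr do rewrite mulmxA.
split=> [[BT ge0] i|Bpsd].
  rewrite tr_mxdiag in BT; have {}BT := (eq_mxdiagP _ _).2 BT.
  split=> [|v]; first exact: BT.
  (* The test vector is [v] in block [i] and 0 elsewhere; the cast is needed as the block size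
     depends on the index. *)
  pose v' j : 'cV[R]_(d j) :=
    if (i =P j) is ReflectT e then castmx (congr1 d e, erefl 1%N) v else 0.
  have v'i : v' i = v.
    by rewrite /v'; case: eqP => // e; rewrite eq_axiomK castmx_id.
  have := ge0 (\mxcol_j v' j); rewrite quad summxE (bigD1 i) //= v'i.
  rewrite big1 ?addr0 // => j /eqP ji; rewrite /v'.
  by case: eqP => [/esym//|_]; rewrite mulmx0 mxE.
split=> [|v].
  rewrite tr_mxdiag; apply/eq_mxdiagP => i; exact: (Bpsd i).1.
rewrite -[v]submxcolK quad summxE; apply: sumr_ge0 => i _.
exact: (Bpsd i).2.
Qed.

Lemma l2norm_psd2 (u x w : R) (v : 'cV[R]_2) :
  v 0 0 = 2 * x -> v 1 0 = u - w -> (l2norm v <= u + w) = `[< psd2 u x w >].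
Proof.
move=> v0 v1; rewrite /l2norm.
have -> : \sum_i v i 0 ^+ 2 = (2 * x) ^+ 2 + (u - w) ^+ 2.
  rewrite !big_ord_recl big_ord0 addr0 -v0 -v1.
  by congr (_ + v _ 0 ^+ 2); apply/val_inj.
have sq : (u + w) ^+ 2 - ((2 * x) ^+ 2 + (u - w) ^+ 2) = 4 * (u * w - x ^+ 2).
  by ring.
have nn : 0 <= (2 * x) ^+ 2 + (u - w) ^+ 2 by rewrite addr_ge0 ?sqr_ge0.
apply/idP/asboolP => [le|[u0 w0 xuw]].
  have uw0 : 0 <= u + w := le_trans (sqrtr_ge0 _) le.
  move: le; rewrite -ler_sqr ?nnegrE ?sqrtr_ge0 // sqr_sqrtr // -subr_ge0 sq.
  rewrite pmulr_rge0 // subr_ge0 => xuw.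
  have uw : 0 <= u * w := le_trans (sqr_ge0 _) xuw.
  (* A nonnegative sum and a nonnegative product force both [u] and [w] to be nonnegative. *)
  by split=> //; nra.
rewrite -ler_sqr ?nnegrE ?sqrtr_ge0 ?addr_ge0 // sqr_sqrtr //.
by rewrite -subr_ge0 sq mulr_ge0 // subr_ge0.
Qed.

Lemma soc_representable_psd2 (N K : nat) (I : finType)
    (U Y W : I -> 'rV[R]_(N + K)) :
  soc_representable (usubmx @` [set z : 'cV_(N + K) | forall i,
    psd2 ((U i *m z) 0 0) ((Y i *m z) 0 0) ((W i *m z) 0 0)]).
Proof.
pose e := @enum_val I predT.
pose P i : 'M[R]_(2, N + K) :=
  \matrix_j if j == 0 then 2 *: Y (e i) else U (e i) - W (e i).
exists K, #|{: I}|, (fun=> 2%N), P, (fun=> 0),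
  (fun i => (U (e i) + W (e i))^T), (fun=> 0).
congr image.
have socE z i : (l2norm (P i *m z + 0) <= ((U (e i) + W (e i))^T^T *m z) 0 0 + 0)
    = `[< psd2 ((U (e i) *m z) 0 0) ((Y (e i) *m z) 0 0)
               ((W (e i) *m z) 0 0) >].
  rewrite !addr0 trmxK mulmxDl [in leRHS]mxE; apply: l2norm_psd2.
    rewrite !mxE mulr_sumr; apply: eq_bigr => j _.
    by rewrite !mxE mulrA.
  rewrite !mxE -sumrB; apply: eq_bigr => j _.
  by rewrite !mxE mulrBl.
apply/seteqP; split=> z /= zP i.
  by rewrite socE; apply/asboolP.
by have := zP (enum_rank i); rewrite socE /e enum_rankK => /asboolP.
Qed.

End BlockPSD.

(** * Products and geometric means along a complete binary tree *)

Section Heap.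
Variable R : realType.

Lemma prod_ord_double (n : nat) (y : nat -> R) :
  \prod_(i < n.*2) y i = \prod_(i < n) (y i.*2 * y i.*2.+1).
Proof.
elim: n => [|n IHn]; first by rewrite !big_ord0.
by rewrite doubleS !big_ord_recr /= IHn mulrA.
Qed.

(** Descending one level squares both sides and replaces each node by its two children. The root
    carries an absolute value because it is nobody's child, so no block fixes its sign. *)
Lemma heap_root_le (m : nat) (y : nat -> R) : (0 < m)%N ->
  (forall h, (0 < h < 2 ^ m)%N -> psd2 (y h.*2) (y h) (y h.*2.+1)) ->
  `|y 1%N| ^+ (2 ^ m) <= \prod_(i < 2 ^ m) y (2 ^ m + i)%N.
Proof.
case: m => // m _ ypsd.
have leaf j (i : nat) : (j < m.+1)%N -> (i < 2 ^ j)%N ->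
    [/\ 0 <= y (2 ^ j.+1 + i.*2)%N, 0 <= y (2 ^ j.+1 + i.*2.+1)%N &
     y (2 ^ j + i)%N ^+ 2
       <= y (2 ^ j.+1 + i.*2)%N * y (2 ^ j.+1 + i.*2.+1)%N].
  move=> jm ij; rewrite addnS expnS mul2n -doubleD; apply: ypsd.
  rewrite addn_gt0 expn_gt0 /= (@leq_trans (2 ^ j.+1)) ?leq_exp2l //.
  by rewrite expnS mul2n -addnn ltn_add2l.
have root_le j : (j <= m)%N ->
    `|y 1%N| ^+ (2 ^ j) <= \prod_(i < 2 ^ j) `|y (2 ^ j + i)%N|.
  elim: j => [_|j IHj jm]; first by rewrite expn0 expr1 big_ord1.
  rewrite expnSr exprM (le_trans (lerXn2r 2 _ _ (IHj (ltnW jm)))) //.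
  - by rewrite nnegrE exprn_ge0.
  - by rewrite nnegrE prodr_ge0.
  rewrite -prodrXl muln2.
  rewrite (prod_ord_double _ (fun i => `|y (_ + i)%N|)).
  apply: ler_prod => i _; rewrite exprn_ge0 //=.
  have [y0 y1 yle] := leaf j i (ltnW jm) (ltn_ord i).
  by rewrite real_normK ?num_real // -muln2 -expnSr !ger0_norm.
rewrite expnSr exprM (le_trans (lerXn2r 2 _ _ (root_le m (leqnn m)))) //.
- by rewrite nnegrE exprn_ge0.
- by rewrite nnegrE prodr_ge0.
rewrite -prodrXl muln2 (prod_ord_double _ (fun i => y (_ + i)%N)).
apply: ler_prod => i _; rewrite exprn_ge0 //=.
have [y0 y1 yle] := leaf m i (ltnSn m) (ltn_ord i).
by rewrite real_normK ?num_real // -muln2 -expnSr.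
Qed.

(** The geometric mean of the values of [z] at the descendants of [h] lying [d] levels below, taken
    by nested square roots so that every block is tight. *)
Fixpoint gmean_tree (z : nat -> R) (d h : nat) : R :=
  if d is d'.+1
  then Num.sqrt (gmean_tree z d' h.*2 * gmean_tree z d' h.*2.+1) else z h.

Lemma gmean_tree_ge0 (z : nat -> R) (d h : nat) :
  (forall i, 0 <= z i) -> 0 <= gmean_tree z d h.
Proof. by case: d => [|d] z0 /=; rewrite ?z0 ?sqrtr_ge0. Qed.

(** The descendants of [h] at relative depth [d] are the nodes [2 ^ d * h + i]; each square root
    uses up one factor 2 of the exponent. *)
Lemma gmean_treeX (z : nat -> R) (d h : nat) : (forall i, 0 <= z i) ->
  gmean_tree z d h ^+ (2 ^ d) = \prod_(i < 2 ^ d) z (2 ^ d * h + i)%N.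
Proof.
move=> z0; elim: d h => [|d IHd] h; first by rewrite expr1 big_ord1 mul1n addn0.
rewrite expnS exprM sqr_sqrtr ?mulr_ge0 ?gmean_tree_ge0 //.
rewrite exprMn !IHd mul2n -[(2 ^ d).*2]addnn big_split_ord /=; congr (_ * _).
  by apply: eq_bigr => i _; congr z; lia.
by apply: eq_bigr => i _; congr z; lia.
Qed.

(** Node [i] has depth [trunc_log 2 i], hence height [m - trunc_log 2 i] above the leaves; its
    children are one level lower. *)
Lemma gmean_tree_psd2 (z : nat -> R) (m h : nat) : (forall i, 0 <= z i) ->
  (0 < h < 2 ^ m)%N ->
  let y i := gmean_tree z (m - trunc_log 2 i) i in
  psd2 (y h.*2) (y h) (y h.*2.+1).
Proof.
move=> z0 /andP[h0 hm] /=.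
have lt_m : (trunc_log 2 h < m)%N.
  by rewrite -(ltn_exp2l _ _ (isT : (1 < 2)%N)) (leq_ltn_trans (trunc_logP _ h0)).
have -> : trunc_log 2 h.*2.+1 = (trunc_log 2 h).+1.
  by rewrite trunc_log2S ?doubleS ?ltnS ?double_gt0 //= uphalf_double.
rewrite trunc_log2_double // -(subnSK lt_m) /=.
split; rewrite ?gmean_tree_ge0 //.
by rewrite sqr_sqrtr ?mulr_ge0 ?gmean_tree_ge0.
Qed.

End Heap.

(** * Multiplicities of the leaf labels *)

Section Arrangement.
Variables (R : realType) (n : nat) (A : {fset 'rV[R]_n}).
Variables (pA : A -> nat) (p m : nat) (u w : 'I_(2 ^ m.-1) -> option A).
Hypothesis uwP : arrangement pA p u w.

Lemma big_option (f : option A -> R) :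
  \prod_s f s = f None * \prod_(a : A) f (Some a).
Proof.
rewrite (bigD1 None) //= (reindex_omap Some id) /=; last by case.
by congr (_ * _); apply: eq_bigl => a; rewrite eqxx.
Qed.

(** Grouping the diagonal slots by label turns the product into powers whose exponents are the
    counts fixed by the arrangement. *)
Lemma prod_arrangement (f : option A -> R) :
  \prod_(l < 2 ^ m.-1) (f (u l) * f (w l))
  = (\prod_(a : A) f (Some a) ^+ pA a) * f None ^+ (2 ^ m - p).
Proof.
have count (v : 'I_(2 ^ m.-1) -> option A) :
    \prod_l f (v l) = \prod_s f s ^+ #|[pred l | v l == s]|.
  rewrite (partition_big v xpredT) //=; apply: eq_bigr => s _.
  rewrite -prodr_const; by apply: eq_big => [l|l /eqP ->].
rewrite big_split /= !count -big_split big_option /= mulrC.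
case: uwP => uwA uwN; congr (_ * _); last by rewrite -exprD uwN.
by apply: eq_bigr => a _; rewrite -exprD uwA.
Qed.

End Arrangement.

(** * The circuit matrix as a heap *)

Section CircuitMatrix.
Variables (R : realType) (n : nat) (A : {fset 'rV[R]_n}) (b : 'rV[R]_n).
Variables (lam : A -> R) (m : nat) (u w : 'I_(2 ^ m.-1) -> option A).

(* In the heap order of the auxiliary variables node [h] has children [2 h] and
   [2 h + 1], so every 2x2 block of the circuit matrix belongs to one node
   [0 < h < 2 ^ m], once the entries of the l-th leaf block are placed at the
   positions [2 ^ m + 2 l] and [2 ^ m + 2 l + 1]. *)
Definition heap (V : nmodType) (xv : nat -> V) (ev : option A -> V) (h : nat) : V :=
  if (h < 2 ^ m)%N then xv h else
  coord (fun l : 'I_(2 ^ m.-1) =>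
    ev (if odd (h - 2 ^ m) then w l else u l)) (h - 2 ^ m)./2.

(** Used to evaluate a heap of linear forms into the heap of their values; [f 0 = 0] covers the junk
    value of [coord]. *)
Lemma heapE (V W : nmodType) (f : V -> W) xv ev xv' ev' h : f 0 = 0 ->
  (forall i, f (xv i) = xv' i) -> (forall s, f (ev s) = ev' s) ->
  f (heap xv ev h) = heap xv' ev' h.
Proof.
move=> f0 xvE evE; rewrite /heap; case: ifP => // _.
by rewrite /coord; case: insub => //= l; rewrite evE.
Qed.

Lemma heap_node (V : nmodType) xv (ev : option A -> V) h :
  (h < 2 ^ m)%N -> heap xv ev h = xv h.
Proof. by rewrite /heap => ->. Qed.

Lemma heap_leaf (V : nmodType) xv (ev : option A -> V) (l : 'I_(2 ^ m.-1)) :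
  (heap xv ev (2 ^ m + l.*2)%N = ev (u l)) *
  (heap xv ev (2 ^ m + l.*2.+1)%N = ev (w l)).
Proof.
rewrite /heap !ltnNge !leq_addr !addKn /= odd_double uphalf_double doubleK.
by rewrite /coord valK.
Qed.

Lemma prod_heap_leaves (xv : nat -> R) (ev : option A -> R) : (0 < m)%N ->
  \prod_(i < 2 ^ m) heap xv ev (2 ^ m + i)%N
  = \prod_(l < 2 ^ m.-1) (ev (u l) * ev (w l)).
Proof.
move=> m0; have m2 : (2 ^ m = (2 ^ m.-1).*2)%N by rewrite -mul2n -expnS prednK.
rewrite -(big_mkord xpredT (fun i => heap xv ev (2 ^ m + i)%N)) [X in index_iota _ X]m2.
rewrite big_mkord (prod_ord_double _ (fun i => heap xv ev (2 ^ m + i)%N)).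
by apply: eq_bigr => l _; rewrite !heap_leaf.
Qed.

Variables (c : {ffun (b |` A)%fset -> R}) (x : {ffun 'I_(2 ^ m) -> R}).

Definition circuit_heap := heap (coord x) (entry lam c x).

(** Nodes below [2 ^ m.-1] give the inner blocks, the remaining ones the leaf blocks; [x_{k,i}] sits
    at depth [m - k]. *)
Lemma psdmx_circuit_matrix : (0 < m)%N ->
  psdmx (circuit_matrix lam u w c x) <->
  [/\ forall h, (0 < h < 2 ^ m)%N ->
        psd2 (circuit_heap h.*2) (circuit_heap h) (circuit_heap h.*2.+1),
      0 <= coord x 1%N - Lambda lam * xbeta x & 0 <= xbeta x + coord c b].
Proof.
move=> m0; rewrite /circuit_matrix /inner_blocks /leaf_blocks.
have m2 : (2 ^ m = (2 ^ m.-1).*2)%N by rewrite -mul2n -expnS prednK.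
have inner h : (h < 2 ^ m.-1)%N ->
    [/\ circuit_heap h = coord x h, circuit_heap h.*2 = coord x h.*2 &
        circuit_heap h.*2.+1 = coord x h.*2.+1].
  by move=> hm; split; apply: heap_node; lia.
have leaf (l : 'I_(2 ^ m.-1)) : let h := (2 ^ m.-1 + l)%N in
    [/\ circuit_heap h = xki x 1 l.+1,
        circuit_heap h.*2 = entry lam c x (u l) &
        circuit_heap h.*2.+1 = entry lam c x (w l)].
  rewrite /= doubleD -addnS -m2 /circuit_heap.
  by rewrite !heap_leaf heap_node ?m2 /xki ?subn1 //; have := ltn_ord l; lia.
have xkiE k i : (k.+2 <= m)%N -> let h := (2 ^ (m - k.+2) + i)%N in
    [/\ xki x k.+2 i.+1 = coord x h,
        xki x k.+1 (2 * i.+1).-1 = coord x h.*2 &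
        xki x k.+1 (2 * i.+1) = coord x h.*2.+1].
  move=> km /=; rewrite /xki.
  have -> : (2 ^ (m - k.+1) = (2 ^ (m - k.+2)).*2)%N.
    by rewrite -mul2n -expnS -subSn.
  by split; congr coord; lia.
split=> [/psdmx_block_diag[innerP /psdmx_block_diag[rootP leafP]]|[heapP r1 r2]].
  have [/psdmx_scalar r1 /psdmx_scalar r2] := (psdmx_block_diag _ _).1 rootP.
  split=> // [h /andP[h0 hm]|]; last by move: r1; rewrite /xki subnn.
  have [hlt|hge] := ltnP h (2 ^ m.-1); last first.
    have lP : (h - 2 ^ m.-1 < 2 ^ m.-1)%N by rewrite ltn_subLR // addnn -m2.
    have /psdmx_mxdiag/(_ (Ordinal lP))/psdmx_sym2 := leafP.
    by have [] := leaf (Ordinal lP); rewrite /= subnKC // => -> -> ->.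
  have /andP[jh hj] := trunc_log_bounds (isT : (1 < 2)%N) h0.
  set j := trunc_log 2 h in jh hj.
  have jm : (j < m.-1)%N.
    by rewrite -(ltn_exp2l _ _ (isT : (1 < 2)%N)) (leq_ltn_trans jh).
  (* A node at depth [j] has [k = m - j]; the block index starts at [k = 2], whence [m - 2 - j]. *)
  have kP : (m.-1 - j.+1 < m.-1)%N by lia.
  have jE : (m - (m.-1 - j.+1).+2 = j)%N by lia.
  have iP : (h - 2 ^ j < 2 ^ (m - (m.-1 - j.+1).+2))%N.
    by rewrite jE ltn_subLR // addnn -mul2n -expnS.
  have := (psdmx_mxdiag _).1 innerP (Ordinal kP).
  move=> /psdmx_mxdiag/(_ (Ordinal iP))/psdmx_sym2 /=.
  have [|-> -> ->] := xkiE (m.-1 - j.+1)%N (h - 2 ^ j)%N; first by lia.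
  by rewrite jE subnKC //; have [-> -> ->] := inner h hlt.
apply/psdmx_block_diag; split.
  apply/psdmx_mxdiag => k; apply/psdmx_mxdiag => i; apply/psdmx_sym2.
  have km : (k.+2 <= m)%N by have := ltn_ord k; lia.
  have [-> -> ->] := xkiE k i km.
  have hlt : (2 ^ (m - k.+2) + i < 2 ^ m.-1)%N.
    rewrite (@leq_trans (2 ^ (m - k.+2).+1)) //.
      by rewrite expnS mul2n -addnn ltn_add2l.
    by rewrite leq_exp2l //; lia.
  have [<- <- <-] := inner _ hlt; apply: heapP.
  by rewrite addn_gt0 expn_gt0 /=; lia.
apply/psdmx_block_diag; split.
  by apply/psdmx_block_diag; split; apply/psdmx_scalar; rewrite // /xki subnn.
apply/psdmx_mxdiag => l; apply/psdmx_sym2.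
have [<- <- <-] := leaf l; apply: heapP.
by rewrite addn_gt0 expn_gt0 /=; have := ltn_ord l; lia.
Qed.

End CircuitMatrix.

(** * Equivalence of cone membership and feasibility, and the second-order representation *)

Section Circuit.
Variables (R : realType) (n : nat) (A : {fset 'rV[R]_n}) (b : 'rV[R]_n).
Variables (lam : A -> R) (pA : A -> nat) (p m : nat).
Variables (u w : 'I_(2 ^ m.-1) -> option A).
Hypotheses (Aind : affinely_independent A) (lamP : barycentric b lam).
Hypothesis lam_gt0 : forall a, 0 < lam a.
Hypotheses (p_gt0 : (0 < p)%N) (lamE : forall a, lam a = (pA a)%:R / p%:R).
Hypotheses (p_le : (p <= 2 ^ m)%N) (uwP : arrangement pA p u w).

Lemma sum_numerators : (\sum_(a : A) pA a = p)%N.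
Proof.
have pR : p%:R != 0 :> R by rewrite pnatr_eq0 -lt0n.
apply/eqP; rewrite -(eqr_nat R) natr_sum; apply/eqP.
transitivity ((\sum_a lam a) * p%:R); last by rewrite (proj2 lamP) mul1r.
by rewrite mulr_suml; apply: eq_bigr => a _; rewrite lamE divfK.
Qed.

(** For [m = 0] the truncated [m.-1] still leaves one leaf block with two diagonal slots, whereas
    the label counts add up to [2 ^ 0 = 1]. *)
Lemma arrangement_depth_gt0 : (0 < m)%N.
Proof.
case: uwP => uwA uwN; rewrite lt0n; apply/eqP => m0.
have card2 (v : 'I_(2 ^ m.-1) -> option A) :
    (\sum_s #|[pred l | v l == s]| = 2 ^ m.-1)%N.
  rewrite -[RHS]card_ord -sum1_card (partition_big v xpredT) //=.
  by apply: eq_bigr => s _; rewrite sum1_card.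
have := congr2 addn (card2 u) (card2 w).
rewrite -big_split /= (bigD1 None) //= (reindex_omap Some id) /=; last by case.
rewrite (eq_bigr pA) => [|a _]; last exact: uwA.
rewrite (eq_bigl xpredT) => [|a]; last by rewrite eqxx.
rewrite sum_numerators uwN; move: p_le p_gt0; rewrite m0 expn0; lia.
Qed.

Let m_gt0 := arrangement_depth_gt0.

Lemma circuit_numberX (y : A -> R) : (forall a, 0 <= y a) ->
  (\prod_a y a `^ lam a) ^+ p = \prod_a y a ^+ pA a.
Proof.
move=> y0; rewrite -prodrXl; apply: eq_bigr => a _.
rewrite -(powR_mulrn p (powR_ge0 _ _)) -powRrM lamE divfK ?powR_mulrn //.
by rewrite pnatr_eq0 -lt0n.
Qed.

Lemma psdmx_circuit_matrix_even_cone (c : {ffun (b |` A)%fset -> R}) x :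
  psdmx (circuit_matrix lam u w c x) -> even_cone A b c.
Proof.
case/(psdmx_circuit_matrix _ _ _ _ _ m_gt0) => heapP r1 r2.
have m2 : (2 ^ m = (2 ^ m.-1).*2)%N by rewrite -mul2n -expnS prednK.
have leaf0 (l : 'I_(2 ^ m.-1)) :
    0 <= entry lam c x (u l) /\ 0 <= entry lam c x (w l).
  have [] := heapP (2 ^ m.-1 + l)%N.
    by rewrite addn_gt0 expn_gt0 /=; have := ltn_ord l; lia.
  by rewrite doubleD -addnS -m2 /circuit_heap !heap_leaf.
(* Since [lam a > 0], the count [pA a] is positive, so [c_a] occurs on the diagonal of some leaf
   block. *)
have cA (a : A) : 0 <= coord c (val a).
  have : (0 < pA a)%N.
    rewrite lt0n; apply/eqP => pa0.
    by have := lam_gt0 a; rewrite lamE pa0 mul0r ltxx.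
  case: uwP => uwA _; rewrite -uwA addn_gt0.
  case/orP => /card_gt0P[l /eqP vl]; by have [] := leaf0 l; rewrite vl.
apply: (circuit_number_even_cone lamP lam_gt0) => //.
set E := \prod_(a : A) _.
have E0 : 0 <= E by apply: prodr_ge0 => a _; apply: powR_ge0.
have L0 := Lambda_gt0 lam_gt0.
set t := Lambda lam * xbeta x in r1.
suff tE : t <= E.
  have : 0 <= Lambda lam * (xbeta x + coord c b) by rewrite mulr_ge0 // ltW.
  by rewrite mulrDr -/t; lra.
have [t0|t0] := lerP t 0; first exact: le_trans t0 E0.
(* Taking [p]-th powers and multiplying by [t ^+ (2 ^ m - p)] makes the right side the product of
   all leaves and the left side [t ^+ (2 ^ m)], which the root dominates. *)
rewrite -(ler_pXn2r p_gt0) ?nnegrE ?(ltW t0) //.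
rewrite circuit_numberX // -(ler_pM2r (exprn_gt0 (2 ^ m - p) t0)).
rewrite -exprD subnKC //.
rewrite -(prod_arrangement uwP (entry lam c x)) -(prod_heap_leaves _ _ (coord x)) //.
apply: le_trans (heap_root_le m_gt0 heapP).
rewrite /circuit_heap heap_node; last by rewrite -{1}(expn0 2) ltn_exp2l.
apply: lerXn2r; rewrite ?nnegrE ?(ltW t0) //.
by apply: le_trans (ler_norm _); rewrite -subr_ge0.
Qed.

Lemma even_cone_psdmx_circuit_matrix (c : {ffun (b |` A)%fset -> R}) :
  even_cone A b c ->
  exists x, psdmx (circuit_matrix lam u w c x).
Proof.
move=> cP; have [cA _] := cP.
have := even_cone_circuit_number Aind lamP lam_gt0 cP.
set E := \prod_(a : A) _ => cE.
have E0 : 0 <= E by apply: prodr_ge0 => a _; apply: powR_ge0.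
have L0 := Lambda_gt0 lam_gt0.
(* The leaves labelled [None] receive [E] outright, since [x] is built from them; [xb] confirms
   afterwards that [Lambda lam * xbeta x] is [E]. *)
pose ev (s : option A) := if s is Some a then coord c (val a) else E.
have ev0 s : 0 <= ev s by case: s => [a|] /=; [exact: cA|].
pose z := heap u w (fun=> 0) ev.
have z0 i : 0 <= z i.
  rewrite /z /heap; case: ifP => // _; rewrite /coord.
  by case: insub => //= l; apply: ev0.
pose y i := gmean_tree z (m - trunc_log 2 i) i.
pose x : {ffun 'I_(2 ^ m) -> R} :=
  [ffun i => if val i == 0%N then E / Lambda lam else y (val i)].
have xE i : (i < 2 ^ m)%N ->
    coord x i = if i == 0%N then E / Lambda lam else y i.
  by move=> im; rewrite /coord insubT /= ffunE.
have xb : Lambda lam * xbeta x = E.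
  by rewrite /xbeta xE ?expn_gt0 //= mulrC divfK // gt_eqF.
have heapE' h : (0 < h < 2 ^ m.+1)%N -> circuit_heap lam u w c x h = y h.
  move=> /andP[h0 hm]; have [hlt|hge] := ltnP h (2 ^ m).
    by rewrite /circuit_heap heap_node // xE // gtn_eqF.
  rewrite /y (@trunc_log_eq 2 m) ?hge // subnn /= /z /circuit_heap /heap.
  rewrite ltnNge hge /=; congr coord; apply/funext => l.
  by case: (if _ then _ else _) => //=; rewrite xb.
have m1 : (1 < 2 ^ m)%N by rewrite -{1}(expn0 2) ltn_exp2l.
(* The leaves multiply to [E ^+ p * E ^+ (2 ^ m - p)], so the root, their [2 ^ m]-th root, is
   [E]. *)
have y1 : y 1%N = E.
  apply/eqP; rewrite -(eqrXn2 (expn_gt0 2 m)) ?gmean_tree_ge0 //.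
  rewrite /y trunc_log1 subn0 gmean_treeX //.
  under eq_bigr do rewrite muln1.
  rewrite prod_heap_leaves // (prod_arrangement uwP) /= -circuit_numberX //.
  by rewrite -exprD subnKC.
exists x; apply/psdmx_circuit_matrix => //; split=> [h /andP[h0 hm]||].
- rewrite !heapE'; try by rewrite expnS; lia.
  by apply: gmean_tree_psd2; rewrite ?h0.
- by rewrite xE //= y1 xb subrr.
- by rewrite -(pmulr_rge0 _ L0) mulrDr xb -lerBlDl sub0r.
Qed.

(** Every block entry is a linear form in [(c, x)], encoded as a row vector, so the blocks are
    finitely many [psd2] constraints on such forms. *)
Lemma soc_representable_even_cone :
  soc_representable (@colvec R _ @` even_cone A b).
Proof.
pose N := #|{: (b |` A)%fset}|; pose K := (2 ^ m)%N.
pose cform (v : 'rV[R]_n) : 'rV[R]_(N + K) :=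
  coord (fun j : (b |` A)%fset => row_mx (delta_mx 0 (enum_rank j)) 0) v.
pose xform (h : nat) : 'rV[R]_(N + K) :=
  coord (fun i : 'I_(2 ^ m) => row_mx 0 (delta_mx 0 i)) h.
pose eform (s : option A) : 'rV[R]_(N + K) :=
  if s is Some a then cform (val a) else Lambda lam *: xform 0%N.
pose hform := heap u w xform eform.
pose l1 := xform 1%N - Lambda lam *: xform 0%N.
pose l2 := xform 0%N + cform b.
(* The left summand indexes heap nodes, where node 0 has no block and gets the trivial constraint;
   the right one indexes the two scalar blocks [r], written as [psd2 r 0 r]. *)
pose U (i : 'I_(2 ^ m) + bool) := match i with
  | inl h => if val h == 0%N then 0 else hform h.*2
  | inr r => if r then l1 else l2 end.
pose W (i : 'I_(2 ^ m) + bool) := match i with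
  | inl h => if val h == 0%N then 0 else hform h.*2.+1
  | inr r => if r then l1 else l2 end.
pose Y (i : 'I_(2 ^ m) + bool) := match i with
  | inl h => if val h == 0%N then 0 else hform h
  | inr r => 0 end.
have psd2_diag (r : R) : psd2 r 0 r <-> 0 <= r.
  by split=> [[]//|r0]; split=> //; rewrite expr0n mulr_ge0.
pose pt (c : {ffun (b |` A)%fset -> R}) (x : {ffun 'I_(2 ^ m) -> R}) :=
  col_mx (colvec c) (\col_i x i).
have psdE c x : psdmx (circuit_matrix lam u w c x) <->
    forall i, psd2 ((U i *m pt c x) 0 0) ((Y i *m pt c x) 0 0)
                   ((W i *m pt c x) 0 0).
  pose ap (f : 'rV[R]_(N + K)) := (f *m pt c x) 0 0.
  have ap0 : ap 0 = 0 by rewrite /ap mul0mx mxE.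
  have apD f g : ap (f + g) = ap f + ap g by rewrite /ap mulmxDl mxE.
  have apZ r f : ap (r *: f) = r * ap f by rewrite /ap -scalemxAl mxE.
  have apB f g : ap (f - g) = ap f - ap g by rewrite apD -scaleN1r apZ mulN1r.
  have apc v : ap (cform v) = coord c v.
    rewrite /cform /coord; case: insub => //= j.
    rewrite /ap mul_row_col mul0mx addr0 -rowE !mxE.
    by rewrite enum_rankK.
  have apx h : ap (xform h) = coord x h.
    rewrite /xform /coord; case: insub => //= j.
    by rewrite /ap mul_row_col mul0mx add0r -rowE !mxE.
  have ape s : ap (eform s) = entry lam c x s.
    by case: s => [a|] /=; rewrite ?apZ ?apc ?apx.
  have aph h : ap (hform h) = circuit_heap lam u w c x h by apply: heapE.
  rewrite psdmx_circuit_matrix //; split=> [[heapP r1 r2] [h|[]]|H].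
  - rewrite -!/(ap _) /=; case: eqP => [_|/eqP h0].
      by rewrite ap0; apply/psd2_diag.
    by rewrite !aph; apply: heapP; rewrite lt0n h0 /=.
  - by rewrite -!/(ap _) /= ap0 apB apZ !apx; apply/psd2_diag.
  - by rewrite -!/(ap _) /= ap0 apD apc apx; apply/psd2_diag.
  split=> [h /andP[h0 hm]||].
  - have := H (inl (Ordinal hm)); rewrite -!/(ap _) /= gtn_eqF //.
    by rewrite !aph.
  - have := H (inr true); rewrite -!/(ap _) /= ap0 apB apZ !apx.
    by move/psd2_diag.
  - have := H (inr false); rewrite -!/(ap _) /= ap0 apD apc apx.
    by move/psd2_diag.
have -> : @colvec R _ @` even_cone A b = usubmx @` [set z : 'cV_(N + K) |
    forall i, psd2 ((U i *m z) 0 0) ((Y i *m z) 0 0) ((W i *m z) 0 0)].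
  apply/seteqP; split=> s /= [].
    move=> c /even_cone_psdmx_circuit_matrix[x /psdE cx] <-.
    by exists (pt c x) => //; rewrite col_mxKu.
  move=> z zP <-.
  pose c : {ffun (b |` A)%fset -> R} := [ffun v => usubmx z (enum_rank v) 0].
  pose x : {ffun 'I_(2 ^ m) -> R} := [ffun i => dsubmx z i 0].
  have cE : colvec c = usubmx z.
    by apply/colP => i; rewrite mxE ffunE enum_valK.
  have zE : z = pt c x.
    rewrite /pt cE -[LHS]vsubmxK; congr col_mx.
    by apply/colP => i; rewrite [RHS]mxE ffunE.
  exists c => //; apply: (@psdmx_circuit_matrix_even_cone _ x).
  by apply/psdE; rewrite -zE.
exact: soc_representable_psd2.
Qed.

End Circuit.

Theorem theorem3p10 (R : realType) (n : nat) (X : {fset 'rV[R]_n})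
  (X_neq0 : X != fset0) (A : {fset 'rV[R]_n}) (b : 'rV[R]_n)
  (Ab_circuit : circuits X (A, b))
  (lam : A -> R) (lamP : barycentric b lam)
  (pA : A -> nat) (p : nat) (pP : smallest_common_denominator lam pA p)
  (m : nat) (mE : m = up_log 2 p)
  (u w : 'I_(2 ^ m.-1) -> option A) (uwP : arrangement pA p u w) :
  even_cone A b =
    (fun cx => restr (b |` A)%fset cx.1) @` circuit_spectrahedron X A b lam u w
  /\ soc_representable (@colvec R _ @` even_cone A b).
Proof.
case: Ab_circuit => /= AX Aind bint; rewrite in_fsetD => /andP[bA bX].
have lam_gt0 := relint_barycentric_gt0 Aind bint lamP.
case: pP => p_gt0 lamE _.
have p_le : (p <= 2 ^ m)%N by rewrite mE up_logP.
split; last first.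
  exact: (soc_representable_even_cone Aind lamP lam_gt0 p_gt0 lamE p_le uwP).
have bAX v : v \in (b |` A)%fset -> v \in X.
  by rewrite in_fset1U => /orP[/eqP->|/(fsubsetP AX)].
apply/seteqP; split=> [c cP|_ [[c x] [/= cxP _] <-]]; last first.
  exact: (psdmx_circuit_matrix_even_cone lamP lam_gt0 p_gt0 lamE p_le uwP cxP).
have [x cxP] :=
  even_cone_psdmx_circuit_matrix Aind lamP lam_gt0 p_gt0 lamE p_le uwP cP.
(* The junk value 0 of [coord] makes this the extension of [c] by zero that the spectrahedron
   requires. *)
pose d : {ffun X -> R} := [ffun v => coord c (val v)].
have dE : restr (b |` A)%fset d = c.
  apply/ffunP => v; rewrite ffunE /coord insubT ?bAX ?(valP v) //= => vX.
  by rewrite ffunE /coord valK.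
rewrite -dE in cxP; exists (d, x); last exact: dE.
split=> [|v vbA]; first exact: cxP.
by rewrite ffunE /coord insubN.
Qed.
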